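(* Let $(P,\prec)$ be a finite poset. Then every permutation $\pi$ of the elements of $P$ converges to exactly one terminal permutation; that is, for every permutation $\pi$ of the elements of $P$ there is exactly one terminal permutation $\sigma$ of the elements of $P$ such that $\sigma$ can be reached from $\pi$ through some finite (possibly empty) sequence of permissible swaps.
   Context: Here $(P,\prec)$ is a finite partially ordered set with $n$ elements, where $\prec$ denotes the strict order relation. A permutation of the elements of $P$ is an ordering $\pi=(x_1,x_2,\ldots,x_n)$ in which each element of $P$ appears exactly once. A swap changes $\pi=(x_1,\ldots,x_n)$ to $(x_1,x_2,\ldots,x_{i-1},x_{i+1},x_i,x_{i+2},\ldots,x_n)$ for some index $i$ with $1\le i\le n-1$ (it exchanges two adjacent entries). This swap is permissible if $x_i\prec x_{i+1}$. A permutation of the elements of $P$ is called terminal if no swap is permissible in it, i.e. there is no index $i$ with $x_i\prec x_{i+1}$. A permutation $\pi$ converges to a terminal permutation $\sigma$ if it is possible to move from $\pi$ to $\sigma$ through some sequence of permissible swaps (each swap being permissible for the permutation to which it is applied). *)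

(* Defs.v *)
From mathcomp Require Import all_boot all_order.
From Stdlib Require Import Relations.Relation_Operators.

Set Implicit Arguments.
Unset Strict Implicit.
Unset Printing Implicit Defensive.

Local Open Scope order_scope.

Definition permutation_of (P : finType) (pi : seq P) : Prop :=
  forall x : P, count_mem x pi = 1%N.

(* The swapped positions are size u and (size u).+1, counting from 0. *)
Definition permissible_swap d (P : finPOrderType d) (pi rho : seq P) : Prop :=
  exists (u v : seq P) (x y : P),
    [/\ pi = u ++ x :: y :: v, rho = u ++ y :: x :: v & x < y].

Definition terminal d (P : finPOrderType d) (sigma : seq P) : Prop :=
  permutation_of sigma /\ ~ exists rho : seq P, permissible_swap sigma rho.

Definition converges_to d (P : finPOrderType d) (pi sigma : seq P) : Prop :=
  terminal sigma /\ clos_refl_trans (seq P) (@permissible_swap d P) pi sigma.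

(* Main.v *)
(* Newman's lemma. Each permissible swap removes exactly one pair of positions
   i < j with x_i < x_j, so swapping terminates. Swaps at disjoint places
   commute, and for overlapping ones, at x < y < z, both [y; x; z] and
   [x; z; y] lead to [z; y; x] because x < z. Local confluence and termination
   give confluence, hence a unique normal form. *)
Require Import Defs.
From mathcomp Require Import all_boot all_order.
From Stdlib Require Import Classical_Prop.
From Stdlib Require Import Relation_Operators Operators_Properties.

Set Implicit Arguments.
Unset Strict Implicit.
Unset Printing Implicit Defensive.

Import Order.TTheory.

Section Newman.

Variables (T : Type) (R : T -> T -> Prop) (m : T -> nat).
Hypothesis mR : forall s t, R s t -> m t < m s.

Let reach := clos_refl_trans T R.

Lemma clos_refl_trans_first s t :
  reach s t -> s = t \/ exists2 r, R s r & reach r t.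
Proof.
move=> st; case: (clos_rt_rt1n _ _ _ _ st) => [|r w Rsr rw]; first by left.
by right; exists r => //; apply: clos_rt1n_rt.
Qed.

(** Induction on [m s]. The two first steps [r1], [r2] rejoin at some [w]; induction at [r1] joins
    [t1] with [w] at [w1], and induction at [r2], which reaches [w1] through [w], joins [w1] with
    [t2]. *)
Lemma newman :
  (forall s t1 t2, R s t1 -> R s t2 -> exists2 w, reach t1 w & reach t2 w) ->
  forall s t1 t2, reach s t1 -> reach s t2 -> exists2 w, reach t1 w & reach t2 w.
Proof.
move=> local_confluence s.
have [n] := ubnP (m s); elim: n s => // n IHn s /ltnSE le_s_n t1 t2.
have IH r : R s r -> m r < n by move=> /mR lt_r_s; apply: leq_trans le_s_n.
move=> st1 st2.
have [<-|[r1 Rsr1 r1t1]] := clos_refl_trans_first st1.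
  by exists t2 => //; apply: rt_refl.
have [<-|[r2 Rsr2 r2t2]] := clos_refl_trans_first st2.
  by exists t1 => //; apply: rt_refl.
have [w r1w r2w] := local_confluence _ _ _ Rsr1 Rsr2.
have [w1 t1w1 ww1] := IHn r1 (IH _ Rsr1) _ _ r1t1 r1w.
have r2w1 : reach r2 w1 by apply: rt_trans ww1.
have [w2 w1w2 t2w2] := IHn r2 (IH _ Rsr2) _ _ r2w1 r2t2.
by exists w2 => //; apply: rt_trans w1w2.
Qed.

Lemma normal_form_exists s :
  exists2 t, reach s t & ~ exists r, R t r.
Proof.
have [n] := ubnP (m s); elim: n s => // n IHn s /ltnSE le_s_n.
(* [R] is an arbitrary relation, so excluded middle decides whether [s] has a successor. *)
have [[r Rsr]|nf_s] := classic (exists r, R s r); last first.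
  by exists s => //; apply: rt_refl.
have [t rt nf_t] := IHn r (leq_trans (mR Rsr) le_s_n).
by exists t => //; apply: rt_trans rt; apply: rt_step.
Qed.

End Newman.

Section Swaps.

Variables (d : Order.disp_t) (P : finPOrderType d).
Implicit Types (s t u v : seq P) (x y : P).

Local Notation swap := (@permissible_swap d P).
Local Notation reach := (clos_refl_trans (seq P) swap).

Fixpoint ascending_pairs s : nat :=
  if s is x :: s' then count (fun y => (x < y)%O) s' + ascending_pairs s'
  else 0.

Lemma swap_perm_eq s t : swap s t -> perm_eq s t.
Proof.
move=> [u [v [x [y [-> -> _]]]]].
by rewrite perm_cat2l -(cat1s x) -(cat1s y v) -(cat1s y (x :: v))
           -(cat1s x v) perm_catCA.
Qed.

Lemma swap_head x y v : (x < y)%O -> swap (x :: y :: v) (y :: x :: v).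
Proof. by move=> lt_xy; exists [::], v, x, y. Qed.

Lemma swap_cons a s t : swap s t -> swap (a :: s) (a :: t).
Proof.
by move=> [u [v [x [y [-> -> lt_xy]]]]]; exists (a :: u), v, x, y.
Qed.

(** Case split on whether the prefix before the swapped pair is empty; this makes induction on the
    sequence possible below. *)
Lemma swap_consP a s t : swap (a :: s) t ->
  (exists y v, [/\ s = y :: v, t = y :: a :: v & (a < y)%O])
  \/ (exists2 t', t = a :: t' & swap s t').
Proof.
move=> [[|b u] [v [x [y [/= [-> ->] -> lt_xy]]]]].
  by left; exists y, v.
by right; exists (u ++ y :: x :: v) => //; exists u, v, x, y.
Qed.

(** A swap at the head loses the pair [a < y], since [y < a] fails by asymmetry, and only regroups
    the other counts. A swap in the tail permutes it, so the count for the head [a] is unchanged. *)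
Lemma swap_ascending_pairs s t :
  swap s t -> ascending_pairs t < ascending_pairs s.
Proof.
elim: s t => [|a s IHs] t; first by case=> -[|? ?] [? [? [? []]]].
case/swap_consP => [[y [v [-> -> lt_ay]]]|[t' -> st']] /=.
  by rewrite lt_ay (lt_gtF lt_ay) add0n -addnA add1n ltnS addnCA leqnn.
by rewrite (permP (swap_perm_eq st')) ltn_add2l IHs.
Qed.

Lemma reach_cons a s t : reach s t -> reach (a :: s) (a :: t).
Proof.
elim=> [x y xy|x|x y z _ xy _ yz].
- exact/rt_step/swap_cons.
- exact: rt_refl.
- exact: rt_trans yz.
Qed.

Lemma swap_head_confluent x y v t : (x < y)%O -> swap (y :: v) t ->
  exists2 w, reach (y :: x :: v) w & reach (x :: t) w.
Proof.
move=> lt_xy /swap_consP[[z [v' [-> -> lt_yz]]]|[t' -> vt']].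
  have lt_xz := lt_trans lt_xy lt_yz.
  (* Overlapping swaps on [x < y < z]: both sides need two more swaps to reverse the triple, one of
     them exchanging [x] and [z]. *)
  exists [:: z, y, x & v'].
    apply: (rt_trans _ _ _ [:: y, z, x & v']); apply: rt_step.
      exact/swap_cons/swap_head.
    exact: swap_head.
  apply: (rt_trans _ _ _ [:: z, x, y & v']); apply: rt_step.
    exact: swap_head.
  exact/swap_cons/swap_head.
(* Disjoint swaps: each side performs the swap that the other has already made. *)
exists [:: y, x & t']; apply: rt_step; first exact/swap_cons/swap_cons.
exact: swap_head.
Qed.

Lemma swap_locally_confluent s t1 t2 : swap s t1 -> swap s t2 ->
  exists2 w, reach t1 w & reach t2 w.
Proof.
elim: s t1 t2 => [|a s IHs] t1 t2; first by case=> -[|? ?] [? [? [? []]]].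
move=> /swap_consP[[y1 [v1 [-> -> lt1]]]|[t1' -> st1]]
       /swap_consP[[y2 [v2 [E2 E2' lt2]]]|[t2' -> st2]].
(* Two swaps at the head are the same swap. *)
- by case: E2 E2' => <- <- ->; exists [:: y1, a & v1]; apply: rt_refl.
- exact: swap_head_confluent.
(* Mirror image of the previous case. *)
- rewrite {}E2 in st1; rewrite {}E2'.
  by have [w] := swap_head_confluent lt2 st1; exists w.
- have [w t1w t2w] := IHs _ _ st1 st2.
  by exists (a :: w); apply: reach_cons.
Qed.

Lemma reach_permutation_of s t :
  reach s t -> permutation_of s -> permutation_of t.
Proof.
elim=> [x y /swap_perm_eq/permP xy px z|//|x y z _ xy _ yz /xy/yz//].
by rewrite -xy.
Qed.

End Swaps.

Theorem theorem1 (d : Order.disp_t) (P : finPOrderType d) (pi : seq P)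
  (pi_perm : permutation_of pi) :
  exists! sigma : seq P, converges_to pi sigma.
Proof.
have [sigma reach_sigma nf_sigma] :=
  normal_form_exists (@swap_ascending_pairs d P) pi.
exists sigma; split.
  by split=> //; split=> //; apply: reach_permutation_of pi_perm.
move=> tau [[_ nf_tau] reach_tau].
have [w sigma_w tau_w] := newman (@swap_ascending_pairs d P)
  (@swap_locally_confluent d P) reach_sigma reach_tau.
(* A normal form reaches only itself, so the common reduct [w] equals both [sigma] and [tau]. *)
have [->|[r sigma_r _]] := clos_refl_trans_first sigma_w; last first.
  by case: nf_sigma; exists r.
have [->//|[r tau_r _]] := clos_refl_trans_first tau_w.
by case: nf_tau; exists r.
Qed.
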